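(* From the base hit with $c\in F_7$, it holds that $H(c)=0$ for $F(1,2)=c$, but $H(c)>0$ for $F(2,3)=c$, $F(3,2)=c$ and $F(1,6)=c$ for odd $c\in F_{sq}$, whereas $H(c)>0$ for $F(1,3)=c$ and $F(1,5)=c$ for even $c\in F_{sq}$ (with $q=7$). Here $c=49K$, with $K$ a positive integer, in all equations, and $F_{sq}=sF'_7$ for $s$ a positive squarefree integer.
   Context: For a positive integer $n$, $R(n)$ is the product of the distinct primes dividing $n$ (with $R(1)=1$), and $Q(n)=n/R(n)$. An $abc$ triple is a triple of pairwise coprime positive integers with $a+b=c$ and $1\le a<b<c$. It is an $abc$ hit if $R(abc)<c$. $H(c)$ is the number of $abc$ hits with third entry $c$; $H(c)>0$ means $c$ has one or more hits and $H(c)=0$ means it has none. For squarefree coprime $d_1,d_2$, the equation $F(d_1,d_2)=c$ means $a+b=c$ with $1\le a<b$, $R(a)=d_1$, $R(b)=d_2$ (the pair is ordered); ''$H(c)=0$ (respectively $H(c)>0$) for $F(d_1,d_2)=c$'' refers to hits arising as solutions of that equation. The class $\overline{m}$ is the set of integers $c>2$ with $Q(c)=m$. For squarefree $q>1$, $F_q$ is the collection of the classes $\overline{m}$ with $R(m)=q$; $c\in F_q$ means that $c>2$ lies in one of these classes, i.e. $R(Q(c))=q$. For a positive squarefree integer $s$ with $\gcd(s,q)=1$ ($s=1$ allowed), $F'_q=\{c\in F_q : s\mid R(c)\}$ (this set depends on $s$) and $sF'_q=\{sc : c\in F'_q\}$. $F_{sq}$ is $F_{q'}$ with $q'=sq$,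 and is also used as a shorthand for the union of the sets $sF'_q$ over all positive squarefree $s$ with $\gcd(s,q)=1$. A base hit in $F_q$ is a hit $(a,b,c)$ solving an equation $F(d_1,d_2)=c$ with $c$ minimal in $F_q$; $(1,2^4\cdot 3,7^2)$ is the base hit in $F_7$. Solutions ''from the base hit'' are those obtained by solving the congruence $a+b\equiv 0\pmod{z}$ with $R(a)=d_1$, $R(b)=d_2$, where $z=R(Q(c))\,Q(c)$ is computed from the initial $c$ (here $z=49$). *)

(* Defs.v *)
From mathcomp Require Import all_boot.

Set Implicit Arguments.
Unset Strict Implicit.
Unset Printing Implicit Defensive.

Definition R (n : nat) : nat := \prod_(p <- primes n) p.

Definition Q (n : nat) : nat := n %/ R n.

Definition squarefree (n : nat) : Prop :=
  0 < n /\ forall d : nat, d ^ 2 %| n -> d = 1.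

Definition abc_triple (a b c : nat) : bool :=
  [&& coprime a b, coprime a c, coprime b c, a + b == c & 1 <= a < b < c].

Definition abc_hit (a b c : nat) : bool :=
  abc_triple a b c && (R (a * b * c) < c).

(* (a, b) is a solution of the equation F(d1, d2) = c *)
Definition solves_F (d1 d2 a b c : nat) : bool :=
  [&& a + b == c, 1 <= a < b, R a == d1 & R b == d2].

(* H(c) for F(d1, d2) = c: the number of hits with third entry c among the
   solutions of that equation.  Both a and b are less than c, so nothing is
   lost by letting them range over 'I_c. *)
Definition H_F (d1 d2 c : nat) : nat :=
  #|[set ab : 'I_c * 'I_c | solves_F d1 d2 ab.1 ab.2 c && abc_hit ab.1 ab.2 c]|.

Definition in_class (m c : nat) : Prop := 2 < c /\ Q c = m.

Definition in_F (q c : nat) : Prop := exists2 m : nat, R m = q & in_class m c.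

(* F'_q, which depends on s *)
Definition in_F' (s q c : nat) : Prop := in_F q c /\ s %| R c.

Definition in_sF' (s q c : nat) : Prop :=
  exists2 c' : nat, in_F' s q c' & c = s * c'.

(* F_{sq} as a shorthand: the union of the sets sF'_q over all squarefree s
   coprime to q, and not the full set in_F (s * q), which is larger than sF'_q
   as soon as s > 1. *)
Definition in_Fs (q c : nat) : Prop :=
  exists s : nat, [/\ squarefree s, coprime s q & in_sF' s q c].

(* c is minimal among the third entries in F_q of hits *)
Definition base_hit (q a b c : nat) : Prop :=
  [/\ abc_hit a b c, in_F q c &
      forall a' b' c' : nat, abc_hit a' b' c' -> in_F q c' -> c <= c'].

(* The modulus z of the congruence a + b = 0 (mod z) *)
Definition base_modulus (c : nat) : nat := R (Q c) * Q c.

(* H(c) > 0 for F(d1, d2) = c, where c ranges over the elements of F_{sq} that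
   are multiples of z and satisfy P: such c for which the equation is solvable
   exist, and all of them have a hit arising from the equation. *)
Definition H_F_positive (P : pred nat) (z q d1 d2 : nat) : Prop :=
  (exists K : nat,
     [/\ 0 < K, P (z * K), in_Fs q (z * K) & 0 < H_F d1 d2 (z * K)]) /\
  (forall K : nat, 0 < K -> P (z * K) -> in_Fs q (z * K) ->
     (exists a b : nat, solves_F d1 d2 a b (z * K)) -> 0 < H_F d1 d2 (z * K)).

(* Main.v *)
(* If p ^ 2 divides c, then p divides Q(c), so Q(c) >= p.  For a solution of
   F(d1, d2) = c with coprime d1, d2 we have R(abc) = d1 * d2 * R(c), which is
   less than c = R(c) * Q(c) exactly when d1 * d2 < Q(c); thus every solution
   with 7 ^ 2 | c and d1 * d2 < 7 is a hit.  For F(1, 2) there is no solution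
   with 7 | c because -1 is not a power of 2 modulo 7. *)
Require Import Defs.
From mathcomp Require Import all_boot.
From mathcomp Require Import zify.

Set Implicit Arguments.
Unset Strict Implicit.
Unset Printing Implicit Defensive.

(** * Radicals and prime supports *)

Lemma prod_primes_gt0 s : all prime s -> 0 < \prod_(p <- s) p.
Proof.
by move=> /allP s_pr; rewrite big_seq prodn_cond_gt0 // => p /s_pr/prime_gt0.
Qed.

Lemma primes_prod_primes s :
  all prime s -> primes (\prod_(p <- s) p) =i s.
Proof.
elim: s => [|q s IHs] /=; first by rewrite big_nil.
case/andP=> q_pr s_pr p; rewrite big_cons primesM ?(prime_gt0 q_pr) ?prod_primes_gt0 //.
by rewrite IHs // primes_prime // !inE.
Qed.

Lemma all_prime_primes n : all prime (primes n).
Proof. by apply/allP => p; rewrite mem_primes => /andP[]. Qed.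

Lemma R_gt0 n : 0 < R n.
Proof. exact/prod_primes_gt0/all_prime_primes. Qed.

(** This turns an equation on [R n] into one on the prime support of [n]: the factorization of [n]
    runs over the primes of [R n]. *)
Lemma primes_R n : primes (R n) = primes n.
Proof.
apply: (irr_sorted_eq ltn_trans ltnn); rewrite ?sorted_primes //.
exact/primes_prod_primes/all_prime_primes.
Qed.

Lemma R_prod_primes s : all prime s -> uniq s ->
  R (\prod_(p <- s) p) = \prod_(p <- s) p.
Proof.
move=> s_pr s_uniq; apply: perm_big.
by apply: uniq_perm => //; [exact: primes_uniq | exact: primes_prod_primes].
Qed.

Lemma coprime_R m n : 0 < m -> 0 < n -> coprime (R m) (R n) = coprime m n.
Proof. by move=> m0 n0; rewrite !coprime_has_primes ?R_gt0 // !primes_R. Qed.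

Lemma R_coprimeM m n : 0 < m -> 0 < n -> coprime m n -> R (m * n) = R m * R n.
Proof.
move=> m0 n0 co_mn; rewrite /R -big_cat; apply: perm_big.
apply: uniq_perm; first exact: primes_uniq.
  by rewrite cat_uniq !primes_uniq -coprime_has_primes // co_mn.
by move=> p; rewrite primesM // mem_cat.
Qed.

Lemma R1 : R 1 = 1.
Proof. by rewrite /R big_nil. Qed.

Lemma R_primeX p e : prime p -> 0 < e -> R (p ^ e) = p.
Proof. by move=> p_pr e0; rewrite /R primesX // primes_prime // big_seq1. Qed.

Lemma R_eq1 n : 0 < n -> R n = 1 -> n = 1.
Proof.
move=> n0 Rn; rewrite (prod_prime_decomp n0) prime_decompE -primes_R Rn.
by rewrite big_nil.
Qed.

Lemma R_eq_prime p n : prime p -> 0 < n -> R n = p -> n = p ^ logn p n.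
Proof.
move=> p_pr n0 Rn; rewrite {1}(prod_prime_decomp n0) prime_decompE.
by rewrite -primes_R Rn primes_prime // big_seq1.
Qed.

Lemma R_dvd n : 0 < n -> R n %| n.
Proof.
move=> n0; rewrite {2}(prod_prime_decomp n0) prime_decompE big_map /R.
rewrite big_seq [X in _ %| X]big_seq; elim/big_rec2: _ => // p m1 m2 p_n.
by apply: dvdn_mul => /=; apply: dvdn_exp; rewrite ?logn_gt0.
Qed.

Lemma R_mulQ n : 0 < n -> R n * Q n = n.
Proof. by move=> n0; rewrite mulnC divnK // R_dvd. Qed.

Lemma Q_gt0 n : 0 < n -> 0 < Q n.
Proof. by move=> n0; rewrite divn_gt0 ?R_gt0 // dvdn_leq ?R_dvd. Qed.

(** Write c = p^(k+2) m with p not dividing m. Then R(c) = p R(m), and cancelling p in R(c) Q(c) = c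
    leaves R(m) Q(c) = p^(k+1) m. As p is coprime to R(m), it divides Q(c). *)
Lemma dvdn_Q p c : prime p -> 0 < c -> p ^ 2 %| c -> p %| Q c.
Proof.
move=> p_pr c0 p2c; have [m co_pm cE] := pfactor_coprime p_pr c0.
have m0 : 0 < m by move: c0; rewrite cE muln_gt0 => /andP[].
move: p2c; rewrite pfactor_dvdn //; move: (logn p c) cE => [|[|k]] // cE _.
have co_m : coprime (p ^ k.+2) m by rewrite coprimeXl.
have := R_mulQ c0.
rewrite {1 3}cE [m * _]mulnC R_coprimeM ?expn_gt0 ?(prime_gt0 p_pr) // R_primeX //.
rewrite [p ^ _]expnS -!mulnA => /eqP; rewrite eqn_pmul2l ?prime_gt0 // => /eqP Q_m.
have : p %| R m * Q c by rewrite Q_m dvdn_mulr // dvdn_exp.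
by rewrite Gauss_dvdr // (coprime_dvdr (R_dvd m0)).
Qed.

(** One factor p comes from Q(c), whose radical is p, the other from R(c), since p divides c = R(c)
    Q(c). *)
Lemma in_F_dvd p c : prime p -> in_F p c -> p ^ 2 %| c.
Proof.
move=> p_pr [m Rm [c_gt2 Qc]].
have c0 : 0 < c by apply: ltn_trans c_gt2.
have p_m : p \in primes m by rewrite -primes_R Rm primes_prime // mem_seq1.
have p_Q : p %| Q c by rewrite Qc; move: p_m; rewrite mem_primes => /and3P[].
have p_c : p \in primes c.
  by rewrite mem_primes p_pr c0 -(R_mulQ c0) dvdn_mull.
rewrite -(R_mulQ c0) expnS expn1 dvdn_mul //.
by move: p_c; rewrite -primes_R mem_primes => /and3P[].
Qed.

(** * Hits and elements of F_{sq} *)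

Lemma solves_F_hit d1 d2 p a b c :
  coprime d1 d2 -> prime p -> d1 * d2 < p -> p ^ 2 %| c ->
  solves_F d1 d2 a b c -> abc_hit a b c.
Proof.
move=> co_d p_pr d_p p2c /and4P[/eqP abc /andP[a0 ab] /eqP Ra /eqP Rb].
have b0 : 0 < b by apply: leq_trans ab.
have c0 : 0 < c by rewrite -abc addn_gt0 a0.
have co_ab : coprime a b by rewrite -coprime_R // Ra Rb.
have co_ac : coprime a c by rewrite -abc /coprime gcdnDl.
have co_bc : coprime b c by rewrite -abc /coprime gcdnDr gcdnC.
apply/andP; split.
  (* The last conjunct of abc_triple parses as [nat_of_bool (1 <= a < b) < c]. *)
  rewrite /abc_triple co_ab co_ac co_bc abc eqxx a0 ab /= -abc.
  by rewrite -[2]/(1 + 1) leq_add.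
rewrite R_coprimeM ?muln_gt0 ?a0 ?coprimeMl ?co_ac // R_coprimeM // Ra Rb.
rewrite -[ltnRHS]R_mulQ // mulnC ltn_pmul2l ?R_gt0 //; apply: leq_trans d_p _.
by rewrite dvdn_leq ?Q_gt0 // dvdn_Q.
Qed.

Lemma H_F_gt0 d1 d2 a b c :
  solves_F d1 d2 a b c -> abc_hit a b c -> 0 < H_F d1 d2 c.
Proof.
move=> sol hit; have /and4P[/eqP abc /andP[a0 ab] _ _] := sol.
have b0 : 0 < b by apply: leq_trans ab.
have ac : a < c by rewrite -abc -{1}[a]addn0 ltn_add2l.
have bc : b < c by rewrite -abc -{1}[b]add0n ltn_add2r.
by apply/card_gt0P; exists (Ordinal ac, Ordinal bc); rewrite inE sol.
Qed.

Lemma squarefree_prime p : prime p -> squarefree p.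
Proof.
move=> p_pr; split=> [|d d2p]; first exact: prime_gt0.
have /(prime_nt_dvdP p_pr) d_p : d %| p by rewrite (dvdn_trans _ d2p) // dvdn_mulr.
have [//|/d_p dE] := eqVneq d 1.
(* The case d = p would give p^2 | p, although p has valuation 1 in itself. *)
by move: d2p; rewrite dE pfactor_dvdn ?prime_gt0 // logn_prime // eqxx.
Qed.

(** The element of F'_p is c' = p^2 times the product of [s], for which Q(c') = p. The multiplier
    [t] is 1 or a prime of [s], hence squarefree, coprime to p and a divisor of R(c'); a [t] in [s]
    becomes a repeated factor of the result. *)
Lemma in_Fs_prod p s t :
  prime p -> all prime s -> uniq s -> p \notin s -> t \in 1 :: s ->
  in_Fs p (t * (p ^ 2 * \prod_(r <- s) r)).
Proof.
move=> p_pr s_pr s_uniq ps ts.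
have s0 : 0 < \prod_(r <- s) r by apply: prod_primes_gt0.
have p0 := prime_gt0 p_pr.
have co_ps : coprime (p ^ 2) (\prod_(r <- s) r).
  rewrite coprimeXl // prime_coprime //; apply: contra ps => p_s.
  by rewrite -(primes_prod_primes s_pr) mem_primes p_pr s0.
have Rc : R (p ^ 2 * \prod_(r <- s) r) = p * \prod_(r <- s) r.
  by rewrite R_coprimeM ?expn_gt0 ?p0 // R_primeX // R_prod_primes.
exists t; split.
- move: ts; rewrite inE => /predU1P[->|/(allP s_pr)]; last exact: squarefree_prime.
  by split=> // d; rewrite dvdn1 (eqn_sqr d 1) => /eqP.
- move: ts; rewrite inE => /predU1P[->|ts]; first exact: coprime1n.
  rewrite coprime_sym prime_coprime // dvdn_prime2 ?(allP s_pr t) //.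
  by apply: contraNneq ps => ->.
exists (p ^ 2 * \prod_(r <- s) r); last by [].
split.
  exists p; first by rewrite -{1}[p]expn1 R_primeX.
  split; last by rewrite /Q Rc expnSr expn1 -mulnA mulnK // muln_gt0 p0.
  apply: leq_trans (leq_pmulr _ s0).
  by rewrite (@leq_trans (2 ^ 2)) // leq_sqr prime_gt1.
rewrite Rc dvdn_mull //; move: ts; rewrite inE => /predU1P[->|ts].
  exact: dvd1n.
by rewrite (big_rem t) //= dvdn_mulr.
Qed.

(** A single solution with factored [c] suffices: the factorization places [c] in F_{sq}, and the
    universal half holds because every solution at a multiple of p^2 is a hit. *)
Lemma H_F_positive_prime (P : pred nat) p d1 d2 a b s t c :
  coprime d1 d2 -> prime p -> d1 * d2 < p ->
  all prime s -> uniq s -> p \notin s -> t \in 1 :: s ->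
  c = p ^ 2 * (t * \prod_(r <- s) r) -> P c -> solves_F d1 d2 a b c ->
  H_F_positive P (p ^ 2) p d1 d2.
Proof.
move=> co_d p_pr d_p s_pr s_uniq ps ts cE Pc sol.
have hit a' b' K : solves_F d1 d2 a' b' (p ^ 2 * K) -> 0 < H_F d1 d2 (p ^ 2 * K).
  move=> sol'; apply: (H_F_gt0 sol').
  by apply: (solves_F_hit co_d p_pr d_p _ sol'); rewrite dvdn_mulr.
split=> [|K _ _ _ [a' [b' /hit]]] //.
have t0 : 0 < t.
  by move: ts; rewrite inE => /predU1P[->|/(allP s_pr)/prime_gt0].
exists (t * \prod_(r <- s) r); rewrite -cE; split=> //.
- by rewrite muln_gt0 t0 prod_primes_gt0.
- by rewrite cE mulnCA; apply: in_Fs_prod.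
- by rewrite cE; apply: (hit a b); rewrite -cE.
Qed.

(** * Explicit solutions for q = 7 *)

Lemma solves_F_powers p q i j :
  prime p -> prime q -> 0 < i -> 0 < j -> p ^ i < q ^ j ->
  solves_F p q (p ^ i) (q ^ j) (p ^ i + q ^ j).
Proof.
move=> p_pr q_pr i0 j0 lt_ij.
by rewrite /solves_F eqxx lt_ij expn_gt0 prime_gt0 //= !R_primeX // !eqxx.
Qed.

Lemma solves_F_1power p e :
  prime p -> 0 < e -> solves_F 1 p 1 (p ^ e) (1 + p ^ e).
Proof.
move=> p_pr e0; rewrite /solves_F eqxx R1 R_primeX // !eqxx !andbT /=.
by rewrite -{1}(expn0 p) ltn_exp2l ?prime_gt1.
Qed.

Lemma R_48 : R 48 = 6.
Proof.
by rewrite (@R_coprimeM (2 ^ 4) 3) // R_primeX // -[3]expn1 R_primeX.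
Qed.

Lemma solves_F_1_48 : solves_F 1 6 1 48 49.
Proof. by rewrite /solves_F R1 R_48. Qed.

(** The triple is a hit because 1 * 6 < 7; it is minimal because 49 divides every element of F_7. *)
Lemma base_hit_7 : base_hit 7 1 48 49.
Proof.
split.
- exact: (@solves_F_hit 1 6 7) solves_F_1_48.
- by exists 7; [rewrite -[7]expn1 R_primeX | split=> //; rewrite /Q (@R_primeX 7 2)].
move=> a b c /andP[/and5P[_ _ _ _ c0] _] /(@in_F_dvd 7)-/(_ isT).
by apply: dvdn_leq; apply: leq_ltn_trans c0.
Qed.

(** Since 2^3 = 8 is 1 modulo 7, the powers of 2 are 1, 2 or 4, and the sum is 2, 3 or 5. *)
Lemma pow2_add1_mod7 j : ~~ (7 %| 1 + 2 ^ j).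
Proof.
have {j}[k [r [-> r3]]] : exists k r, j = k * 3 + r /\ r < 3.
  by exists (j %/ 3), (j %% 3); rewrite -divn_eq ltn_mod.
have k1 : 2 ^ (k * 3) %% 7 = 1 by rewrite mulnC expnM -modnXm (exp1n k).
rewrite expnD /dvdn -modnDmr -modnMml k1 mul1n modnDmr.
by case: r r3 => [|[|[|]]].
Qed.

Lemma H_F_1_2_eq0 c : 7 %| c -> H_F 1 2 c = 0.
Proof.
move=> c7; apply: eq_card0 => -[a b]; rewrite inE; apply/negP => /andP[/= sol _].
case/and4P: sol => /eqP abc /andP[a0 ab] /eqP/(R_eq1 a0) a1 /eqP Rb.
have bE := R_eq_prime (isT : prime 2) (leq_trans (ltn0Sn _) ab) Rb.
by move: c7; rewrite -abc a1 bE (negPf (pow2_add1_mod7 _)).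
Qed.

(* 21 is the least exponent e with 49 | 1 + 3 ^ e, and likewise for 5; these sums
   are not in F'_7 with s = 1 because 4 (resp. 9) divides them, so the repeated
   factor 2 (resp. 3) has to be taken as s. *)
Lemma sum_1_3X21 :
  1 + 3 ^ 21 = 7 ^ 2 * (2 * \prod_(p <- [:: 2; 43; 547; 2269]) p).
Proof. rewrite !big_cons big_nil; lia. Qed.

Lemma sum_1_5X21 :
  1 + 5 ^ 21 = 7 ^ 2 * (3 * \prod_(p <- [:: 2; 3; 29; 43; 127; 449; 7603]) p).
Proof.
(* Literals above 5000 are opaque to lia. *)
have -> : 7603 = 4000 + 3603 by [].
rewrite !big_cons big_nil; lia.
Qed.

Theorem proposition8 :
  [/\ base_hit 7 1 (2 ^ 4 * 3) (7 ^ 2) /\ base_modulus (7 ^ 2) = 49,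
      forall K : nat, 0 < K -> H_F 1 2 (49 * K) = 0,
      forall d1 d2 : nat, (d1, d2) \in [:: (2, 3); (3, 2); (1, 6)] ->
        H_F_positive (fun c => odd c) 49 7 d1 d2
    & forall d1 d2 : nat, (d1, d2) \in [:: (1, 3); (1, 5)] ->
        H_F_positive (fun c => ~~ odd c) 49 7 d1 d2].
Proof.
split.
- split; first exact: base_hit_7.
  by rewrite /base_modulus /Q !(@R_primeX 7 2, @R_primeX 7 1).
- by move=> K _; apply: H_F_1_2_eq0; rewrite dvdn_mulr.
- move=> d1 d2; rewrite !inE => /or3P[]/eqP[-> ->].
  (* 2 + 3^5 = 245 = 49 * 5. *)
  + have sol := @solves_F_powers 2 3 1 5 isT isT isT isT isT.
    by apply: (@H_F_positive_prime _ 7 _ _ _ _ [:: 5] 1) sol; rewrite ?big_seq1.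
  (* 3^3 + 2^9 = 539 = 49 * 11. *)
  + have sol := @solves_F_powers 3 2 3 9 isT isT isT isT isT.
    by apply: (@H_F_positive_prime _ 7 _ _ _ _ [:: 11] 1) sol; rewrite ?big_seq1.
  (* The base hit itself, with c = 49 and K the empty product. *)
  + apply: (@H_F_positive_prime _ 7 _ _ _ _ [::] 1) solves_F_1_48 => //.
    by rewrite big_nil.
- move=> d1 d2; rewrite !inE => /orP[]/eqP[-> ->].
  + have even_c : ~~ odd (1 + 3 ^ 21) by rewrite oddD oddX.
    have sol := @solves_F_1power 3 21 isT isT.
    exact: (@H_F_positive_prime (fun c => ~~ odd c) 7 1 3 _ _ [:: 2; 43; 547; 2269] 2 _
      isT isT isT isT isT isT isT sum_1_3X21 even_c sol).
  + have even_c : ~~ odd (1 + 5 ^ 21) by rewrite oddD oddX.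
    have sol := @solves_F_1power 5 21 isT isT.
    exact: (@H_F_positive_prime (fun c => ~~ odd c) 7 1 5 _ _
      [:: 2; 3; 29; 43; 127; 449; 7603] 3 _
      isT isT isT isT isT isT isT sum_1_5X21 even_c sol).
Qed.
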